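(* The generating functions $F_{x,y}(z)=\sum_{n\ge2}\alpha_n(x,y)\frac{z^n}{n!}$ (for $x,y\in\{\mathbf{a},\mathbf{b}\}$) and $F(z)=\sum_{n\ge2}\alpha_n\frac{z^n}{n!}$ are given by $$\begin{aligned}F_{\mathbf{a},\mathbf{a}}(z)&=\frac{1}{1-z}\cdot\left(e^z-4+4e^{-z}\right)-1+2z,\\ F_{\mathbf{a},\mathbf{b}}(z)&=\frac{1}{1-z}\cdot\left(1-2e^{-z}\right)+1-z,\\ F_{\mathbf{b},\mathbf{b}}(z)&=\frac{1}{1-z}\cdot e^{-z}-1,\\ F(z)&=\frac{1}{1-z}\cdot\left(e^z-2+e^{-z}\right).\end{aligned}$$
   Context: The descent word of a permutation $\pi=\pi_1\cdots\pi_n\in\mathfrak{S}_n$ is $u(\pi)=u_1\cdots u_{n-1}$, with $u_i=\mathbf{a}$ if $\pi_i<\pi_{i+1}$ and $u_i=\mathbf{b}$ if $\pi_i>\pi_{i+1}$. Set $\mathrm{wt}(\mathbf{aa})=0$, $\mathrm{wt}(\mathbf{bb})=2$, $\mathrm{wt}(\mathbf{ab})=\mathrm{wt}(\mathbf{ba})=1$, and $\mathrm{Wt}(\pi)=\prod_{i=1}^{n-2}\mathrm{wt}(u_iu_{i+1})$ (an empty product is $1$). For $n\ge2$, $\alpha_n=\sum_{\pi\in\mathfrak{S}_n}\mathrm{Wt}(\pi)$, and for $x,y\in\{\mathbf{a},\mathbf{b}\}$, $\alpha_n(x,y)=\sum\mathrm{Wt}(\pi)$ over all $\pi\in\mathfrak{S}_n$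 whose descent word begins with the letter $x$ and ends with the letter $y$. Generating functions may be read as formal power series. *)

(* Defs.v *)
From HB Require Import structures.
From mathcomp Require Import all_boot all_order all_algebra all_fingroup.
From mathcomp Require Import boolp.

Set Implicit Arguments.
Unset Strict Implicit.
Unset Printing Implicit Defensive.

Import GRing.Theory.
Local Open Scope ring_scope.

(* Formal power series in one variable z over a field, as a commutative ring
   in which the units are the series with nonzero constant coefficient.
   Equality of series is made boolean, as the algebraic hierarchy requires,
   by classical axioms. *)

Record fps (K : Type) := Fps { fcoef : nat -> K }.

HB.instance Definition _ (K : Type) := gen_eqMixin (fps K).
HB.instance Definition _ (K : Type) := gen_choiceMixin (fps K).

Lemma fpsP (K : Type) (f g : fps K) :
  (forall n, fcoef f n = fcoef g n) <-> f = g.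
Proof.
split=> [|-> //]; case: f g => [f] [g] /= fg.
by congr Fps; apply: funext.
Qed.

Section FpsRing.
Variable K : fieldType.
Implicit Types f g h : fps K.

Definition fps_zero : fps K := Fps (fun=> 0).
Definition fps_opp f : fps K := Fps (fun n => - fcoef f n).
Definition fps_add f g : fps K := Fps (fun n => fcoef f n + fcoef g n).

Fact fps_addA : associative fps_add.
Proof. by move=> f g h; apply/fpsP => n /=; rewrite addrA. Qed.
Fact fps_addC : commutative fps_add.
Proof. by move=> f g; apply/fpsP => n /=; rewrite addrC. Qed.
Fact fps_add0 : left_id fps_zero fps_add.
Proof. by move=> f; apply/fpsP => n /=; rewrite add0r. Qed.
Fact fps_addN : left_inverse fps_zero fps_opp fps_add.
Proof. by move=> f; apply/fpsP => n /=; rewrite addNr. Qed.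

HB.instance Definition _ := GRing.isZmodule.Build (fps K)
  fps_addA fps_addC fps_add0 fps_addN.

Definition fps_one : fps K := Fps (fun n => (n == 0%N)%:R).
Definition fps_mul f g : fps K :=
  Fps (fun n => \sum_(i < n.+1) fcoef f i * fcoef g (n - i)%N).

Definition fps_trunc (N : nat) f : {poly K} := \poly_(i < N) fcoef f i.

Lemma coef_fps_trunc N f i : (i < N)%N -> (fps_trunc N f)`_i = fcoef f i.
Proof. by move=> iN; rewrite coef_poly iN. Qed.

Lemma fps_mulE N f g n : (n < N)%N ->
  fcoef (fps_mul f g) n = (fps_trunc N f * fps_trunc N g)`_n.
Proof.
move=> nN; rewrite coefM; apply: eq_bigr => i _.
rewrite !coef_fps_trunc //; first by apply: leq_ltn_trans nN; apply: leq_subr.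
by apply: leq_ltn_trans nN; rewrite -ltnS.
Qed.

Fact fps_mulA : associative fps_mul.
Proof.
move=> f g h; apply/fpsP => n.
transitivity ((fps_trunc n.+1 f * (fps_trunc n.+1 g * fps_trunc n.+1 h))`_n).
  rewrite coefM; apply: eq_bigr => i _; rewrite coef_fps_trunc //.
  by rewrite -fps_mulE // ltnS leq_subr.
rewrite mulrA coefM; apply: eq_bigr => i _; rewrite -fps_mulE //.
by rewrite coef_fps_trunc // ltnS leq_subr.
Qed.

Fact fps_mulC : commutative fps_mul.
Proof.
by move=> f g; apply/fpsP => n; rewrite !(fps_mulE _ _ (ltnSn n)) mulrC.
Qed.

Fact fps_mul1 : left_id fps_one fps_mul.
Proof.
move=> f; apply/fpsP => n /=; rewrite big_ord_recl /= mul1r subn0.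
by rewrite big1 ?addr0 // => i _; rewrite mul0r.
Qed.

Fact fps_mulDl : left_distributive fps_mul fps_add.
Proof.
move=> f g h; apply/fpsP => n /=; rewrite -big_split /=.
by apply: eq_bigr => i _; rewrite mulrDl.
Qed.

Fact fps_one_neq0 : fps_one != fps_zero.
Proof.
apply/eqP => /fpsP /(_ 0%N) /= /eqP; rewrite oner_eq0; exact/negP.
Qed.

HB.instance Definition _ := GRing.Zmodule_isComNzRing.Build (fps K)
  fps_mulA fps_mulC fps_mul1 fps_mulDl fps_one_neq0.

Definition fpsC (c : K) : fps K := Fps (fun n => if n is 0%N then c else 0).

Definition fpsX : fps K := Fps (fun n => (n == 1%N)%:R).

Definition fps_unit : pred (fps K) := fun f => fcoef f 0 != 0.

(* f = c (1 - u) with c = f(0) and u(0) = 0, so f^-1 = c^-1 \sum_k u^k;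
   only the terms with k <= n contribute to the coefficient of z^n. *)
Definition fps_inv f : fps K :=
  if fps_unit f then
    let c := fcoef f 0 in
    let u := 1 - fpsC c^-1 * f in
    Fps (fun n => c^-1 * fcoef (\sum_(k < n.+1) u ^+ k) n)
  else f.

Lemma fcoef0 n : fcoef (0 : fps K) n = 0. Proof. by []. Qed.
Lemma fcoef1 n : fcoef (1 : fps K) n = (n == 0%N)%:R. Proof. by []. Qed.
Lemma fcoefD f g n : fcoef (f + g) n = fcoef f n + fcoef g n.
Proof. by []. Qed.
Lemma fcoefN f n : fcoef (- f) n = - fcoef f n. Proof. by []. Qed.
Lemma fcoefB f g n : fcoef (f - g) n = fcoef f n - fcoef g n.
Proof. by []. Qed.
Lemma fcoefM f g n :
  fcoef (f * g) n = \sum_(i < n.+1) fcoef f i * fcoef g (n - i)%N.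
Proof. by []. Qed.

Lemma fcoef_sum (I : Type) (r : seq I) (P : pred I) (F : I -> fps K) n :
  fcoef (\sum_(i <- r | P i) F i) n = \sum_(i <- r | P i) fcoef (F i) n.
Proof. exact: (big_morph (fun f => fcoef f n) (fun _ _ => erefl) erefl). Qed.

Lemma fcoefCM c f n : fcoef (fpsC c * f) n = c * fcoef f n.
Proof.
rewrite fcoefM big_ord_recl /= subn0 big1 ?addr0 // => i _.
by rewrite mul0r.
Qed.

Lemma fcoef_expr_lt (u : fps K) k n :
  fcoef u 0 = 0 -> (n < k)%N -> fcoef (u ^+ k) n = 0.
Proof.
move=> u0; elim: k n => // k IHk n nk.
rewrite exprS fcoefM big_ord_recl u0 mul0r add0r big1 // => i _.
rewrite IHk ?mulr0 //= /bump /= add1n.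
by case: n i nk => [[]//|n] i nk; rewrite subSS (leq_ltn_trans (leq_subr _ _)).
Qed.

Fact fps_mulVf : {in fps_unit, left_inverse 1 fps_inv *%R}.
Proof.
move=> f uf; rewrite /fps_inv (_ : fps_unit f = true) //.
set c := fcoef f 0; set u := 1 - fpsC c^-1 * f.
have c0 : c != 0 by [].
have u0 : fcoef u 0 = 0 by rewrite fcoefB fcoefCM fcoef1 mulVf // subrr.
apply/fpsP => n.
transitivity (fcoef (fpsC c^-1 * (\sum_(k < n.+1) u ^+ k) * f) n).
  rewrite !fcoefM; apply: eq_bigr => i _; rewrite fcoefCM /=.
  congr (_ * _ * _); rewrite !fcoef_sum.
  rewrite (big_ord_widen n.+1 (fun k => fcoef (u ^+ k) i)) // big_mkcond /=.
  apply: eq_bigr => k _; case: ltnP => // ik.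
  by rewrite fcoef_expr_lt.
rewrite -mulrA [X in _ * X]mulrC mulrA.
have -> : fpsC c^-1 * f = 1 - u by rewrite /u opprB addrC subrK.
have -> : (1 - u) * (\sum_(k < n.+1) u ^+ k) = 1 - u ^+ n.+1.
  by rewrite -[in RHS](expr1n _ n.+1) subrXX; congr (_ * _);
     apply: eq_bigr => i _; rewrite expr1n mul1r.
by rewrite fcoefB fcoef_expr_lt // subr0.
Qed.

Fact fps_unitPl f g : g * f = 1 -> fps_unit f.
Proof.
move/fpsP/(_ 0%N); rewrite fcoefM big_ord1 fcoef1 /= => gf.
by apply/eqP => f0; move/eqP: gf; rewrite f0 mulr0 eq_sym oner_eq0.
Qed.

Fact fps_inv_out : {in [predC fps_unit], fps_inv =1 id}.
Proof. by move=> f; rewrite /fps_inv => /negbTE; rewrite -[f \in _]/(fps_unit f) => ->. Qed.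

HB.instance Definition _ := GRing.ComNzRing_hasMulInverse.Build (fps K)
  fps_mulVf fps_unitPl fps_inv_out.

(* The series e^{c z}. *)
Definition fps_exp (c : K) : fps K := Fps (fun n => c ^+ n / n`!%:R).

(* The exponential generating function of a sequence indexed by n >= 2. *)
Definition egf2 (s : nat -> nat) : fps K :=
  Fps (fun n => if (2 <= n)%N then (s n)%:R / n`!%:R else 0).

End FpsRing.

Arguments fpsX {K}.

Inductive letter := la | lb.

Definition letter_is_b (x : letter) := if x is lb then true else false.
Definition letter_of_bool (d : bool) := if d then lb else la.
Fact letter_is_bK : cancel letter_is_b letter_of_bool.
Proof. by case. Qed.
HB.instance Definition _ := Equality.copy letter (can_type letter_is_bK).

Definition oneline n (p : 'S_n) : seq nat := [seq val (p i) | i <- enum 'I_n].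

Definition descent_letter (x y : nat) : letter := if (x < y)%N then la else lb.

Definition descent_word n (p : 'S_n) : seq letter :=
  if oneline p is x :: w then pairmap descent_letter x w else [::].

Definition wt (x y : letter) : nat :=
  match x, y with
  | la, la => 0
  | lb, lb => 2
  | la, lb | lb, la => 1
  end.

(* zip drops the last, unmatched letter, leaving the pairs (u_i, u_(i+1)). *)
Definition Wt n (p : 'S_n) : nat :=
  let u := descent_word p in
  (\prod_(xy <- zip u (behead u)) wt xy.1 xy.2)%N.

Definition alpha (n : nat) : nat := (\sum_(p : 'S_n) Wt p)%N.

Definition alpha_xy (x y : letter) (n : nat) : nat :=
  (\sum_(p : 'S_n |
      prefix [:: x] (descent_word p) && suffix [:: y] (descent_word p)) Wt p)%N.

Definition genF : fps rat := egf2 rat alpha.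
Definition genFxy (x y : letter) : fps rat := egf2 rat (alpha_xy x y).

(* Main.v *)
(* Delete the last value of a permutation.  Let a_n(k), b_n(k) be the total
   weight of the permutations of size n with a fixed first descent letter, last
   value k in {0, ..., n-1} and last descent letter a, respectively b.  Then
     a_{n+1}(k) = \sum_(j < k) b_n(j),
     b_{n+1}(k) = \sum_(k <= j < n) (a_n(j) + 2 b_n(j)).
   For these weights h_n = a_n + b_n satisfies the closed difference equation
   h_{n+1}(k+1) = h_{n+1}(k) - h_n(k), which gives, up to boundary terms,
     a_{n+1}(k+1) = (k + 1) h_n(k),   b_{n+1}(k) = (n - k) h_n(k).
   At the ends of the rows these become first-order recurrences for the totals
   B_n = \sum_k b_n(k) = a_{n+1}(n) and A_n + 2 B_n = b_{n+1}(0), and such a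
   recurrence s_{n+1} = (n + 1) s_n + r_{n+1} says that (1 - z) times the
   exponential generating function of s is that of r. *)
Require Import Defs.
From mathcomp Require Import all_boot all_order all_algebra all_fingroup.
From mathcomp Require Import ring lra zify.

Set Implicit Arguments.
Unset Strict Implicit.
Unset Printing Implicit Defensive.

Import GRing.Theory Num.Theory.
Local Open Scope ring_scope.

(** * Deleting the last entry: effect on sums, descent words and weights *)

(** [lift_perm i j] is a bijection onto the permutations sending [i] to [j]; its inverse deletes
    position [i] and value [j] and renumbers. *)
Lemma sum_lift_perm (n : nat) (i j : 'I_n.+1) (P : pred 'S_n.+1)
    (F : 'S_n.+1 -> nat) :
  (\sum_(p : 'S_n.+1 | P p && (p i == j)) F p
   = \sum_(s : 'S_n | P (lift_perm i j s)) F (lift_perm i j s))%N.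
Proof.
(* The default [k] never occurs, since injectivity of [p] gives [p (lift i k) != p i]. *)
pose unl (p : 'S_n.+1) (k : 'I_n) : 'I_n := odflt k (unlift (p i) (p (lift i k))).
have unlK (p : 'S_n.+1) (k : 'I_n) : lift (p i) (unl p k) = p (lift i k).
  rewrite /unl; have := neq_lift i k.
  by rewrite -(can_eq (permK p)) => /unlift_some[] ? ? ->.
have unl_inj (p : 'S_n.+1) : injective (unl p).
  move=> k l /(congr1 (lift (p i))); rewrite !unlK.
  by move/perm_inj/lift_inj.
rewrite (reindex (lift_perm i j)).
  by apply: eq_bigl => s; rewrite lift_perm_id eqxx andbT.
exists (fun p => perm (unl_inj p)) => [s _ | p].
  apply/permP => k; rewrite permE; apply: (@lift_inj _ j).
  by rewrite -{1}(lift_perm_id i j s) unlK lift_perm_lift.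
case/andP => _ /eqP pij; apply/permP => k.
have [l|] := unliftP i k => ->; last by rewrite lift_perm_id.
by rewrite lift_perm_lift permE -pij unlK.
Qed.

(** Works on plain sequences, where entries can be renumbered and appended; [descent_word p] is
    convertible to [descents (oneline p)]. *)
Definition descents (s : seq nat) : seq letter :=
  if s is x :: w then pairmap descent_letter x w else [::].

Lemma descents_map_bump k s : descents (map (bump k) s) = descents s.
Proof.
case: s => //= x s; elim: s x => //= y s IHs x; rewrite IHs.
by congr (_ :: _); rewrite /descent_letter ltnNge leq_bump2 -ltnNge.
Qed.

Lemma descents_rcons s x y :
  descents (rcons (rcons s x) y) = rcons (descents (rcons s x)) (descent_letter x y).
Proof.
case: s => //= z s; elim: s z => //= t s IHs z; by rewrite IHs.
Qed.

Lemma oneline_rcons n (p : 'S_n.+1) :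
  oneline p = rcons [seq val (p (widen_ord (leqnSn n) i)) | i <- enum 'I_n]
                    (p ord_max).
Proof. by rewrite /oneline enum_ordSr map_rcons -map_comp. Qed.

Lemma oneline_lift_perm n (k : 'I_n.+1) (s : 'S_n) :
  oneline (lift_perm ord_max k s) = rcons (map (bump k) (oneline s)) k.
Proof.
rewrite oneline_rcons lift_perm_id /oneline -[in RHS]map_comp; congr rcons.
apply: eq_map => i /=.
have -> : widen_ord (leqnSn n) i = lift ord_max i.
  by apply: val_inj; rewrite /= /bump leqNgt ltn_ord.
by rewrite lift_perm_lift.
Qed.

Lemma descent_word_lift_perm n (k : 'I_n.+2) (s : 'S_n.+1) :
  descent_word (lift_perm ord_max k s)
  = rcons (descent_word s) (descent_letter (s ord_max) k).
Proof.
change (descents (oneline (lift_perm ord_max k s)) =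
  rcons (descents (oneline s)) (descent_letter (s ord_max) k)).
rewrite oneline_lift_perm oneline_rcons map_rcons descents_rcons -map_rcons.
(* An old last value equal to [k] is bumped above [k], so the tie is a descent, as [descent_letter]
   has it. *)
rewrite descents_map_bump; congr rcons; rewrite /descent_letter /bump.
by have [ks|sk] := leqP k (s ord_max); case: ltnP => //; lia.
Qed.

Lemma size_descent_word n (p : 'S_n.+1) : size (descent_word p) = n.
Proof.
change (size (descents (oneline p)) = n).
have: size (oneline p) = n.+1 by rewrite size_map size_enum_ord.
by case: oneline => //= x w []; rewrite size_pairmap.
Qed.

Definition word_wt (u : seq letter) : nat :=
  (\prod_(xy <- zip u (behead u)) wt xy.1 xy.2)%N.

Lemma word_wt_rcons u x y :
  word_wt (rcons (rcons u x) y) = (word_wt (rcons u x) * wt x y)%N.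
Proof.
rewrite /word_wt; case: u => [|t u] /=.
  by rewrite big_cons !big_nil muln1 mul1n.
elim: u t => [|r u IHu] t /=; first by rewrite !big_cons !big_nil !muln1.
by rewrite big_cons IHu [in RHS]big_cons mulnA.
Qed.

(** * Weights refined by last value, and their recurrences *)

(* The index n stands for permutations of size n + 1, with values 0, ..., n. *)
Definition letter_sum (x y : letter) (n k : nat) : nat :=
  (\sum_(p : 'S_n.+1 | [&& prefix [:: x] (descent_word p),
     suffix [:: y] (descent_word p) & val (p ord_max) == k]) Wt p)%N.

Lemma alpha_xy_letter_sum x y n :
  alpha_xy x y n.+1 = (\sum_(k < n.+1) letter_sum x y n k)%N.
Proof.
rewrite /alpha_xy (partition_big (fun p : 'S_n.+1 => p ord_max) predT) //=.
by apply: eq_bigr => k _; apply: eq_bigl => p; rewrite -andbA.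
Qed.

Lemma alpha_alpha_xy n :
  alpha n.+2 = (alpha_xy la la n.+2 + alpha_xy la lb n.+2
                + (alpha_xy lb la n.+2 + alpha_xy lb lb n.+2))%N.
Proof.
rewrite /alpha (bigID (fun p : 'S_n.+2 => prefix [:: la] (descent_word p))) /=.
rewrite (bigID (fun p : 'S_n.+2 => suffix [:: la] (descent_word p))) /=.
rewrite [X in (_ + X)%N](bigID (fun p : 'S_n.+2 => suffix [:: la] (descent_word p))) /=.
have pre (p : 'S_n.+2) :
  ~~ prefix [:: la] (descent_word p) = prefix [:: lb] (descent_word p).
  by have := size_descent_word p; case: descent_word => [|[] u];
     rewrite //= !prefix0s.
have suf (p : 'S_n.+2) :
  ~~ suffix [:: la] (descent_word p) = suffix [:: lb] (descent_word p).
  have := size_descent_word p; case/lastP: (descent_word p) => // u c _.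
  by rewrite !(suffix_rcons [::]) !suffix0s !andbT; case: c.
by congr ((_ + _) + (_ + _))%N; apply: eq_bigl => p; rewrite ?pre ?suf.
Qed.

(** The shorter permutation still has a descent letter, so deletion keeps the first letter and
    removes one factor [wt]. *)
Lemma letter_sum_rec x y n (k : 'I_n.+3) :
  letter_sum x y n.+2 k =
  (\sum_(j < n.+2 | descent_letter j k == y)
     (wt la y * letter_sum x la n.+1 j + wt lb y * letter_sum x lb n.+1 j))%N.
Proof.
rewrite /letter_sum.
under eq_bigl => p do rewrite andbA val_eqE.
rewrite sum_lift_perm.
(* The default [la] of [last] is never reached: the descent word of [s] is nonempty. *)
set G := fun s : 'S_n.+2 => (Wt s * wt (last la (descent_word s)) y)%N.
transitivity (\sum_(s : 'S_n.+2 | prefix [:: x] (descent_word s) &&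
   (descent_letter (s ord_max) k == y)) G s)%N.
  apply: eq_big => s.
    rewrite descent_word_lift_perm (suffix_rcons [::]) suffix0s andbT.
    rewrite [y == _]eq_sym; congr andb.
    by have := size_descent_word s; case: descent_word => //= c u _; rewrite !prefix0s.
  rewrite descent_word_lift_perm (suffix_rcons [::]) suffix0s andbT.
  rewrite /G => /andP[_ /eqP ->].
  change (word_wt (descent_word (lift_perm ord_max k s)) =
    word_wt (descent_word s)
    * wt (last la (descent_word s)) (descent_letter (s ord_max) k))%N.
  rewrite descent_word_lift_perm; have := size_descent_word s.
  by case/lastP: (descent_word s) => // u c _; rewrite word_wt_rcons last_rcons.
rewrite (partition_big (fun p : 'S_n.+2 => p ord_max)
  (fun j : 'I_n.+2 => descent_letter j k == y)) /=; last by move=> p /andP[].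
apply: eq_bigr => j /eqP jk.
rewrite (bigID (fun p : 'S_n.+2 => suffix [:: la] (descent_word p))) /=.
rewrite !big_distrr /=; congr addn; apply: eq_big => s.
- rewrite val_eqE -!andbA; congr andb.
  have [->|_] := eqVneq (s ord_max) j; last by rewrite !andbF.
  by rewrite jk eqxx andbT.
- case/andP=> _ ; rewrite /G mulnC; case/lastP: (descent_word s) => // u c.
  by rewrite (suffix_rcons [::]) suffix0s andbT last_rcons => /eqP <-.
- rewrite val_eqE -!andbA; congr andb.
  have [->|_] := eqVneq (s ord_max) j; last by rewrite !andbF.
  rewrite jk eqxx andbT /=.
  have := size_descent_word s; case/lastP: (descent_word s) => // u c _.
  by rewrite !(suffix_rcons [::]) !suffix0s !andbT; case: c.
- case/andP=> _ ; rewrite /G mulnC; have := size_descent_word s.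
  case/lastP: (descent_word s) => // u c _.
  by rewrite (suffix_rcons [::]) suffix0s andbT last_rcons; case: c.
Qed.

Lemma letter_sum_base x y (k : 'I_2) :
  letter_sum x y 1 k = ((x == y) && (descent_letter 0 k == y)).
Proof.
rewrite /letter_sum.
under eq_bigl => p do rewrite andbA val_eqE.
rewrite sum_lift_perm.
have dw (s : 'S_1) : descent_word (lift_perm ord_max k s)
    = [:: descent_letter 0 k].
  rewrite descent_word_lift_perm /= (ord1 (s _)).
  by have := size_descent_word s; case: descent_word.
under eq_bigl => s do rewrite dw.
under eq_bigr => s _.
  rewrite (_ : Wt _ = 1%N); last by rewrite /Wt dw /= big_nil.
  over.
rewrite sum1_card; case: (boolP (_ && _)) => [xy|].
  have -> : (x == y) && (descent_letter 0 k == y).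
    by move: xy; rewrite (suffix_rcons [::] [::]) /=;
     case: x; case: y; case: descent_letter.
  rewrite -[RHS](card_Sn 1); apply: eq_card => s; by rewrite !inE.
rewrite (suffix_rcons [::] [::]) /= => xy.
rewrite eq_card0 //; by move: xy; case: x; case: y; case: descent_letter.
Qed.

Lemma letter_sum_la x n k : (k <= n.+2)%N ->
  letter_sum x la n.+2 k = (\sum_(0 <= j < k) letter_sum x lb n.+1 j)%N.
Proof.
move=> kn; rewrite (letter_sum_rec x la (Ordinal (kn : (k < n.+3)%N))) /=.
rewrite (big_nat_widen 0 k n.+2) // big_mkord.
apply: eq_big => [j|j _]; last by rewrite mul0n add0n mul1n.
by rewrite /descent_letter; case: ltnP.
Qed.

Lemma letter_sum_lb x n k : (k <= n.+2)%N ->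
  letter_sum x lb n.+2 k =
  (\sum_(k <= j < n.+2) (letter_sum x la n.+1 j + 2 * letter_sum x lb n.+1 j))%N.
Proof.
move=> kn; rewrite (letter_sum_rec x lb (Ordinal (kn : (k < n.+3)%N))) /=.
rewrite (big_nat_widenl k 0) // big_mkord.
apply: eq_big => [j|j _]; last by rewrite mul1n.
by rewrite /descent_letter; case: ltnP.
Qed.

(** * Closed forms in terms of the previous row *)

(* The index m stands for permutations of size m + 2, the least size having a
   descent letter. *)
Definition letter_sumQ x y m k : rat := (letter_sum x y m.+1 k)%:R.
(** Carries the initial condition, so both first letters are treated at once. *)
Definition is_la x : rat := (x == la)%:R.

Lemma letter_sumQ_la0 x m : letter_sumQ x la m.+1 0 = 0.
Proof. by rewrite /letter_sumQ letter_sum_la // big_geq. Qed.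

Lemma letter_sumQ_laS x m k : (k < m.+2)%N ->
  letter_sumQ x la m.+1 k.+1 = letter_sumQ x la m.+1 k + letter_sumQ x lb m k.
Proof.
by move=> km; rewrite /letter_sumQ !letter_sum_la ?big_nat_recr ?natrD // ltnW.
Qed.

Lemma letter_sumQ_lb_max x m : letter_sumQ x lb m.+1 m.+2 = 0.
Proof. by rewrite /letter_sumQ letter_sum_lb // big_geq. Qed.

Lemma letter_sumQ_lbS x m k : (k < m.+2)%N ->
  letter_sumQ x lb m.+1 k = letter_sumQ x lb m.+1 k.+1
                            + letter_sumQ x la m k + 2 * letter_sumQ x lb m k.
Proof.
move=> km; rewrite /letter_sumQ letter_sum_lb 1?ltnW // big_ltn //.
rewrite -letter_sum_lb // natrD [X in X + _]natrD natrM; ring.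
Qed.

Lemma letter_sumQ_base x :
  [/\ letter_sumQ x la 0 0 = 0, letter_sumQ x la 0 1 = is_la x,
      letter_sumQ x lb 0 0 = 1 - is_la x & letter_sumQ x lb 0 1 = 0].
Proof.
rewrite /letter_sumQ /is_la.
have base y k (k2 : (k < 2)%N) := letter_sum_base x y (Ordinal k2).
by rewrite !base //; case: x {base}; split; rewrite //= ?subrr ?subr0.
Qed.

(** From [k] to [k.+1] the [la] part gains b and the [lb] part loses a + 2b, a net loss of a + b. *)
Lemma letter_sumQ_diff x m k : (k < m.+2)%N ->
  letter_sumQ x la m k + letter_sumQ x lb m k =
  letter_sumQ x la m.+1 k + letter_sumQ x lb m.+1 k
  - (letter_sumQ x la m.+1 k.+1 + letter_sumQ x lb m.+1 k.+1).
Proof. by move=> km; rewrite letter_sumQ_laS // letter_sumQ_lbS //; ring. Qed.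

(** The boundary term starts at the top value for [m = 0]; each step moves it from [(m, k)] to
    [(m.+1, k.+1)] and flips its sign. *)
Lemma letter_sumQ_la_closed x m k : (k <= m.+1)%N ->
  letter_sumQ x la m.+1 k.+1 =
  k.+1%:R * (letter_sumQ x la m k + letter_sumQ x lb m k)
  + (k == m.+1)%:R * (1 - 3 * is_la x) * (-1) ^+ m.
Proof.
elim: m k => [|m IHm] k.
  have [a00 a01 b00 b01] := letter_sumQ_base x.
  case: k => [|[|//]] _; rewrite !letter_sumQ_laS // letter_sumQ_la0;
    rewrite b00 ?a00 ?a01 ?b01 /=; ring.
elim: k => [|k IHk] km.
  by rewrite letter_sumQ_laS // !letter_sumQ_la0 /=; ring.
rewrite letter_sumQ_laS // IHk 1?ltnW // ltn_eqF // eqSS.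
(* The difference equation trades the row-[m] sum in [IHm] for two neighbours in row [m.+1], one of
   which is in [IHk]. *)
move: (IHm k km); rewrite letter_sumQ_diff // exprS -[k.+2%:R]natr1 /=.
lra.
Qed.

(** Here the boundary term stays at [k = 0] with unchanged sign. At [k = m.+2], outside row [m], the
    coefficient vanishes. *)
Lemma letter_sumQ_lb_closed x m k : (k <= m.+2)%N ->
  letter_sumQ x lb m.+1 k =
  (m.+2%:R - k%:R) * (letter_sumQ x la m k + letter_sumQ x lb m k)
  + (k == 0)%:R * is_la x.
Proof.
elim: m k => [|m IHm] k km.
  have [a00 a01 b00 b01] := letter_sumQ_base x.
  have b2 := letter_sumQ_lb_max x 0.
  have b1 := @letter_sumQ_lbS x 0 1 isT.
  have b0 := @letter_sumQ_lbS x 0 0 isT.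
  case: k km => [|[|[|//]]] _; rewrite ?b0 ?b1 b2 ?a00 ?b00 ?a01 ?b01 /=; ring.
(* Descending induction on [k], from the top value where the [lb] sum is empty. *)
rewrite -(subKn km); elim: (m.+3 - k)%N (leq_subr k m.+3) => [|i IHi] im.
  by rewrite subn0 letter_sumQ_lb_max /=; ring.
move: (IHi (ltnW im)).
have -> : (m.+3 - i = (m.+3 - i.+1).+1)%N by lia.
have : (m.+3 - i.+1 < m.+3)%N by lia.
move: (m.+3 - i.+1)%N => j jm IHj.
rewrite letter_sumQ_lbS // IHj -[m.+3%:R]natr1 -[j.+1%:R]natr1 /=.
have [jm' | mj] := ltnP j m.+2.
  by move: (IHm j jm); rewrite letter_sumQ_diff //; lra.
(* The difference equation is out of range here; the claim reduces to the vanishing of the [lb]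
   weight at the top value. *)
have -> : j = m.+2 by lia.
rewrite letter_sumQ_lb_max /=; lra.
Qed.

(** * First-order recurrences for the totals *)

Lemma natr_alpha_xy x y m :
  (alpha_xy x y m.+2)%:R = \sum_(0 <= k < m.+2) letter_sumQ x y m k.
Proof. by rewrite alpha_xy_letter_sum natr_sum big_mkord. Qed.

(** Appending the maximum forces an ascent, of weight 0 after [la] and 1 after [lb]. *)
Lemma natr_alpha_lb x m :
  (alpha_xy x lb m.+2)%:R = letter_sumQ x la m.+1 m.+2.
Proof. by rewrite natr_alpha_xy /letter_sumQ letter_sum_la // natr_sum. Qed.

(** Appending the minimum forces a descent, of weight 1 after [la] and 2 after [lb]. *)
Lemma natr_alpha_la_lb x m :
  (alpha_xy x la m.+2)%:R + 2 * (alpha_xy x lb m.+2)%:R = letter_sumQ x lb m.+1 0.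
Proof.
rewrite !natr_alpha_xy /letter_sumQ letter_sum_lb // natr_sum big_distrr -big_split.
by apply: eq_bigr => k _; rewrite natrD natrM.
Qed.

Lemma alpha_lb2 x : (alpha_xy x lb 2)%:R = 1 - is_la x :> rat.
Proof.
have [a00 a01 b00 b01] := letter_sumQ_base x.
by rewrite natr_alpha_xy big_ltn // big_nat1 b00 b01 addr0.
Qed.

Lemma alpha_lb_rec x m :
  (alpha_xy x lb m.+3)%:R = m.+3%:R * (alpha_xy x lb m.+2)%:R
                            - (1 - 3 * is_la x) * (-1) ^+ m :> rat.
Proof.
rewrite !natr_alpha_lb letter_sumQ_la_closed // letter_sumQ_lb_max eqxx exprS /=.
ring.
Qed.

Lemma alpha_la_lb2 x :
  (alpha_xy x la 2)%:R + 2 * (alpha_xy x lb 2)%:R = 2 - is_la x :> rat.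
Proof.
have [a00 a01 b00 b01] := letter_sumQ_base x.
rewrite alpha_lb2 (natr_alpha_xy x la) big_ltn // big_nat1 a00 a01; ring.
Qed.

Lemma alpha_la_lb_rec x m :
  (alpha_xy x la m.+3)%:R + 2 * (alpha_xy x lb m.+3)%:R =
  m.+3%:R * ((alpha_xy x la m.+2)%:R + 2 * (alpha_xy x lb m.+2)%:R)
  + is_la x :> rat.
Proof.
rewrite !natr_alpha_la_lb letter_sumQ_lb_closed // letter_sumQ_la0 eqxx subr0 /=; ring.
Qed.

(** * From recurrences to generating functions *)

Lemma fcoefXM (K : fieldType) (f : fps K) n :
  fcoef (fpsX * f) n = if n is m.+1 then fcoef f m else 0.
Proof.
rewrite fcoefM big_ord_recl mul0r add0r.
case: n => [|n]; first by rewrite big_ord0.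
rewrite big_ord_recl mul1r subn1 big1 ?addr0 // => i _.
by rewrite mul0r.
Qed.

Lemma unit_subX (K : fieldType) : (1 - fpsX : fps K) \is a GRing.unit.
Proof. by rewrite unfold_in /= /fps_unit fcoefB fcoef1 subr0 oner_eq0. Qed.

Lemma fcoef_subXM (K : fieldType) (f : fps K) n :
  fcoef ((1 - fpsX) * f) n.+1 = fcoef f n.+1 - fcoef f n.
Proof. by rewrite mulrBl mul1r fcoefB fcoefXM. Qed.

Lemma fpsC_nat (K : fieldType) n : fpsC n%:R = n%:R :> fps K.
Proof.
elim: n => [|n IHn]; first by apply/fpsP => -[].
rewrite -[in RHS]natr1 -IHn -natr1; apply/fpsP => -[|k] //=.
by rewrite addr0.
Qed.

Lemma fpsCN (K : fieldType) (c : K) : fpsC (- c) = - fpsC c.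
Proof. by apply/fpsP => -[|n] //=; rewrite oppr0. Qed.

(** From degree 3 on, the inhomogeneous term of [alpha_lb_rec] is an alternating sign, giving the
    tail of [fps_exp (- 1)]; the [fpsX * fpsX] term corrects degree 2. *)
Lemma genF_lb x :
  (1 - fpsX) * genFxy x lb =
  fpsC (1 - 3 * is_la x) * (fps_exp (- 1) - (1 - fpsX))
  + fpsC (is_la x) * (fpsX * fpsX).
Proof.
apply/fpsP => -[|[|[|n]]].
- rewrite mulrBl mul1r !(fcoefD, fcoefN, fcoefCM, fcoefXM) /=.
  by rewrite fact0 expr0; field.
- rewrite fcoef_subXM !(fcoefD, fcoefN, fcoefCM, fcoefXM) /=.
  by rewrite factS fact0 expr1; field.
- rewrite fcoef_subXM !(fcoefD, fcoefN, fcoefCM, fcoefXM) /=.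
  by rewrite alpha_lb2 !factS fact0; field.
rewrite fcoef_subXM !(fcoefD, fcoefN, fcoefCM, fcoefXM) /=.
rewrite alpha_lb_rec [n.+3`!]factS natrM !exprS.
have fn0 : n.+2`!%:R != 0 :> rat by rewrite pnatr_eq0 -lt0n fact_gt0.
have n3 : n.+3%:R != 0 :> rat by rewrite pnatr_eq0.
by field; rewrite fn0 -natrD n3.
Qed.

(** Here the inhomogeneous term is the constant [is_la x], giving a tail of [fps_exp 1]. *)
Lemma genF_la_lb x :
  (1 - fpsX) * (genFxy x la + 2 * genFxy x lb) =
  fpsC (is_la x) * (fps_exp 1 - 1 - fpsX - fpsX * fpsX) + fpsX * fpsX.
Proof.
rewrite -(fpsC_nat _ 2).
apply/fpsP => -[|[|[|n]]].
- rewrite mulrBl mul1r !(fcoefD, fcoefN, fcoefCM, fcoefXM) /=.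
  by rewrite fact0 expr0; field.
- rewrite fcoef_subXM !(fcoefD, fcoefN, fcoefCM, fcoefXM) /=.
  by rewrite factS fact0 expr1; field.
- rewrite fcoef_subXM !(fcoefD, fcoefN, fcoefCM, fcoefXM) /=.
  have := alpha_la_lb2 x.
  rewrite !factS fact0 expr1n => /(canRL (addrK _)) ->.
  by field.
rewrite fcoef_subXM !(fcoefD, fcoefN, fcoefCM, fcoefXM) /=.
rewrite expr1n [n.+3`!]factS natrM.
have fn0 : n.+2`!%:R != 0 :> rat by rewrite pnatr_eq0 -lt0n fact_gt0.
have n3 : n.+3%:R != 0 :> rat by rewrite pnatr_eq0.
have := alpha_la_lb_rec x n => /(canRL (addrK _)) ->.
by field; rewrite fn0 -natrD n3.
Qed.

Lemma genF_sum :
  genF = genFxy la la + genFxy la lb + (genFxy lb la + genFxy lb lb).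
Proof.
apply/fpsP => -[|[|n]]; rewrite !fcoefD /= ?addr0 //.
by rewrite -!mulrDl -!natrD alpha_alpha_xy.
Qed.

Lemma div_subX (K : fieldType) (f g h : fps K) :
  (1 - fpsX) * f = g + (1 - fpsX) * h -> f = 1 / (1 - fpsX) * g + h.
Proof.
move=> fgh; apply: (mulrI (unit_subX K)).
by rewrite fgh mulrDr mul1r mulrA divrr ?unit_subX // mul1r.
Qed.

Theorem theorem6p4 :
  let z : fps rat := fpsX in
  let exp_z : fps rat := fps_exp 1 in
  let exp_Nz : fps rat := fps_exp (- 1) in
  [/\ genFxy la la = 1 / (1 - z) * (exp_z - 4 + 4 * exp_Nz) - 1 + 2 * z,
      genFxy la lb = 1 / (1 - z) * (1 - 2 * exp_Nz) + 1 - z,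
      genFxy lb lb = 1 / (1 - z) * exp_Nz - 1
    & genF = 1 / (1 - z) * (exp_z - 2 + exp_Nz)].
Proof.
move=> /=.
have ab := genF_lb la; have aa := genF_la_lb la.
have bb := genF_lb lb; have ba := genF_la_lb lb.
have c1 : fpsC (1 - 3 * is_la la) = - 2 :> fps rat.
  by rewrite -(fpsC_nat _ 2) -fpsCN; congr fpsC; rewrite /is_la eqxx /=; ring.
have c2 : fpsC (is_la la) = 1 :> fps rat by exact: (fpsC_nat _ 1).
have c3 : fpsC (1 - 3 * is_la lb) = 1 :> fps rat.
  by rewrite /is_la mulr0 subr0; apply: (fpsC_nat _ 1).
have c4 : fpsC (is_la lb) = 0 :> fps rat by exact: (fpsC_nat _ 0).
rewrite c1 c2 in ab; rewrite c2 in aa; rewrite c4 in ba; rewrite c3 c4 in bb.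
(* Reassociating gathers the trailing polynomial into the [h] of [div_subX]. *)
rewrite -!addrA; split.
- apply: div_subX.
  transitivity ((1 - fpsX) * (genFxy la la + 2 * genFxy la lb)
                - 2 * ((1 - fpsX) * genFxy la lb)); first by ring.
  by rewrite aa ab; ring.
- by apply: div_subX; rewrite ab; ring.
- by apply: div_subX; rewrite bb; ring.
rewrite -[RHS]addr0; apply: div_subX; rewrite genF_sum.
(* For each first letter, the total is the combination known from [genF_la_lb] minus one [lb]
   series. *)
transitivity ((1 - fpsX) * (genFxy la la + 2 * genFxy la lb)
              + (1 - fpsX) * (genFxy lb la + 2 * genFxy lb lb)
              - (1 - fpsX) * genFxy la lb - (1 - fpsX) * genFxy lb lb);
  first by ring.
by rewrite aa ab ba bb; ring.
Qed.
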